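(* Let $A$ be an entrywise nonnegative real $m\times n$ matrix with no zero row and no zero column, let $r_1,\dots,r_m,c_1,\dots,c_n$ be positive real numbers, and let $B=\lim_{k\to\infty}B(k)$ be the limit of the row-adjusted iterates of the iterative scaling procedure started at $A$. Then the splitting obtained by applying Step I to $(A,r,c)$ and then applying Step II to every block of the splitting produced by Step I is exactly the decomposition of $B$ (whichever admissible subsets are chosen in the executions of Step II).
   Context: Iterative scaling procedure (ISP). For a nonnegative $m\times n$ matrix $M$ with no zero row, $\mathcal R(M)$ is the matrix with $(i,j)$ entry $x_i m_{ij}$, where $x_i=r_i/\sum_j m_{ij}$; for $M$ with no zero column, $\mathcal C(M)$ is the matrix with $(i,j)$ entry $m_{ij}y_j$, where $y_j=c_j/\sum_i m_{ij}$. Put $B(1)=\mathcal R(A)$, $C(k)=\mathcal C(B(k))$ for $k\ge 1$, and $B(k)=\mathcal R(C(k-1))$ for $k\ge 2$. It is known (Csiszár–Shields) that $B(k)$ and $C(k)$ converge as $k\to\infty$. The equality $\sum_i r_i=\sum_j c_j$ is not assumed. The limit $B$ has no zero row and no zero column. Notation. For a set $I$ of rows, $r(I)=\sum_{i\in I}r_i$; for a set $J$ of columns, $c(J)=\sum_{j\in J}c_j$. For a set $I$ of rows of a matrix $A$, $N(I)=\{j:\exists i\in I,\ a_{ij}\ne 0\}$. For row set $I$ and column set $J$, $A[I,J]$ is the corresponding submatrix, and $r_{|I}$, $c_{|J}$ are the restrictions of the row and column sum data. Blocks and splittings. A block is a pair $(I,J)$ with $I$ a set of rows and $J$ a set of columns.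 A splitting is a set of blocks (with nonempty components) whose row sets partition the set of rows and whose column sets partition the set of columns. A splitting is refined by repeatedly replacing a block $(I,J)$ by two blocks $(I_1,J_1),(I_2,J_2)$ where $I_1,I_2$ partition $I$ and $J_1,J_2$ partition $J$. The decomposition of a matrix $B$ with no zero row or column is the finest splitting $(I_1,J_1),\dots,(I_s,J_s)$ such that $b_{ij}\neq 0$ implies $i\in I_k$ and $j\in J_k$ for some $k$ (equivalently, its blocks are the connected components of the bipartite graph on rows and columns whose edges are the pairs $(i,j)$ with $b_{ij}\ne0$). The set $\varphi(A,r,c)$. This is the nonempty set $I$ of rows for which $r(I)/c(N(I))$ is maximal and, among the sets attaining this maximum, $|I|$ is maximal (such a set is unique). Step I. Let $I_1=\varphi(A,r,c)$ and $J_1=N(I_1)$. Delete the rows $I_1$ and columns $J_1$ and repeat with the remaining submatrix and the restricted data: having found $(I_1,J_1),\dots,(I_{k-1},J_{k-1})$, let $I'$ and $J'$ be the remaining rows and columns; if they are nonempty, set $I_k=\varphi(A[I',J'],r_{|I'},c_{|J'})$ and let $J_k\subseteq J'$ be the set of columns $j\in J'$ such that $a_{ij}\neq0$ for some $i\in I_k$. Continue until no rows or columns remain. The output is the splitting consisting of the blocks $(I_k,J_k)$. Step II, applied to a block $(P,Q)$. If there is a nonempty proper subset $I\subsetneq P$ with $r(I)=\frac{r(P)}{c(Q)}\,c(N(I)\cap Q)$, choose such an $I$, replace $(P,Q)$ by the two blocks $(I,N(I)\cap Q)$ and $(P\setminus I,\,Q\setminus N(I))$, and apply Step II recursively to each of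 these two blocks. If there is no such $I$, output the block $(P,Q)$ itself. *)

(* Defs.v *)
From HB Require Import structures.
From mathcomp Require Import all_boot all_order all_algebra.

Set Implicit Arguments.
Unset Strict Implicit.
Unset Printing Implicit Defensive.

Import Order.TTheory GRing.Theory Num.Theory.

Local Open Scope ring_scope.

Definition row_scale (R : realFieldType) (m n : nat) (r : 'I_m -> R)
    (M : 'M[R]_(m, n)) : 'M[R]_(m, n) :=
  \matrix_(i, j) (r i / (\sum_(k < n) M i k) * M i j).

Definition col_scale (R : realFieldType) (m n : nat) (c : 'I_n -> R)
    (M : 'M[R]_(m, n)) : 'M[R]_(m, n) :=
  \matrix_(i, j) (M i j * (c j / (\sum_(k < m) M k j))).

(* Indices start at 0: ispB A r c k is the iterate B(k+1). *)
Fixpoint ispB (R : realFieldType) (m n : nat) (A : 'M[R]_(m, n))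
    (r : 'I_m -> R) (c : 'I_n -> R) (k : nat) : 'M[R]_(m, n) :=
  if k is k'.+1 then row_scale r (col_scale c (ispB A r c k'))
  else row_scale r A.

Definition sumset (R : realFieldType) (p : nat) (f : 'I_p -> R)
    (I : {set 'I_p}) : R :=
  \sum_(i in I) f i.

(* A submatrix A[P, Q] is represented by A together with P and Q, so that its
   rows and columns keep their names; nbr A Q I is the N(I) of A[P, Q] for any
   P containing I, that is, N(I) :&: Q. *)
Definition nbr (R : realFieldType) (m n : nat) (A : 'M[R]_(m, n))
    (Q : {set 'I_n}) (I : {set 'I_m}) : {set 'I_n} :=
  [set j in Q | [exists i in I, A i j != 0]].

Definition block (m n : nat) : finType := ({set 'I_m} * {set 'I_n})%type.

(* A set of blocks could contain two blocks sharing the same row set; the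
   injectivity conditions exclude this, so that the row sets (column sets) of
   distinct blocks are disjoint. The components are nonempty because the parts
   of a partition are. *)
Definition is_splitting (m n : nat) (S : {set block m n}) : Prop :=
  [/\ {in S &, injective fst}, {in S &, injective snd},
      partition [set b.1 | b in S] [set: 'I_m] &
      partition [set b.2 | b in S] [set: 'I_n]].

Definition splits_in_two (p : nat) (I I1 I2 : {set 'I_p}) : Prop :=
  [/\ I1 != set0, I2 != set0, [disjoint I1 & I2] & I1 :|: I2 = I].

(* refines S T : T is obtained from S by finitely many replacements. *)
Inductive refines (m n : nat) (S : {set block m n}) : {set block m n} -> Prop :=
| refines_refl : refines S S
| refines_step (T : {set block m n}) (b b1 b2 : block m n) :
    refines S T -> b \in T ->
    splits_in_two b.1 b1.1 b2.1 -> splits_in_two b.2 b1.2 b2.2 ->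
    refines S ([set b1; b2] :|: (T :\ b)).

Definition covers_support (R : realFieldType) (m n : nat) (B : 'M[R]_(m, n))
    (S : {set block m n}) : Prop :=
  forall i j, B i j != 0 -> exists2 b, b \in S & (i \in b.1) && (j \in b.2).

Definition is_decomposition (R : realFieldType) (m n : nat) (B : 'M[R]_(m, n))
    (S : {set block m n}) : Prop :=
  [/\ is_splitting S, covers_support B S &
      forall T, is_splitting T -> covers_support B T -> refines T S].

(* The denominator vanishes (and the quotient is then 0) only when I has no
   neighbor in Q. If A has no zero row and r, c are positive, this never happens
   for a nonempty set I of rows remaining in an execution of Step I: adding I to
   the maximizer chosen last would have increased its ratio. *)
Definition ratio (R : realFieldType) (m n : nat) (A : 'M[R]_(m, n))
    (r : 'I_m -> R) (c : 'I_n -> R) (Q : {set 'I_n}) (I : {set 'I_m}) : R :=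
  sumset r I / sumset c (nbr A Q I).

(* I is phi(A[P, Q], r_|P, c_|Q). *)
Definition is_phi (R : realFieldType) (m n : nat) (A : 'M[R]_(m, n))
    (r : 'I_m -> R) (c : 'I_n -> R) (P : {set 'I_m}) (Q : {set 'I_n})
    (I : {set 'I_m}) : Prop :=
  [/\ I != set0, I \subset P,
      forall K : {set 'I_m}, K != set0 -> K \subset P ->
        ratio A r c Q K <= ratio A r c Q I &
      forall K : {set 'I_m}, K != set0 -> K \subset P ->
        ratio A r c Q K = ratio A r c Q I -> (#|K| <= #|I|)%N].

(* stepI A r c P Q S : started with the rows P and columns Q remaining, Step I
   runs until nothing is left and outputs the blocks S. *)
Inductive stepI (R : realFieldType) (m n : nat) (A : 'M[R]_(m, n))
    (r : 'I_m -> R) (c : 'I_n -> R) :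
    {set 'I_m} -> {set 'I_n} -> {set block m n} -> Prop :=
| stepI_stop : stepI A r c set0 set0 set0
| stepI_next (P : {set 'I_m}) (Q : {set 'I_n}) (I : {set 'I_m})
    (S : {set block m n}) :
    P != set0 -> Q != set0 -> is_phi A r c P Q I ->
    stepI A r c (P :\: I) (Q :\: nbr A Q I) S ->
    stepI A r c P Q ((I, nbr A Q I) |: S).

Definition admissible (R : realFieldType) (m n : nat) (A : 'M[R]_(m, n))
    (r : 'I_m -> R) (c : 'I_n -> R) (b : block m n) (I : {set 'I_m}) : Prop :=
  [/\ I != set0, I \proper b.1 &
      sumset r I = sumset r b.1 / sumset c b.2 * sumset c (nbr A b.2 I)].

(* stepII A r c b S : some execution of Step II on the block b outputs S. *)
Inductive stepII (R : realFieldType) (m n : nat) (A : 'M[R]_(m, n))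
    (r : 'I_m -> R) (c : 'I_n -> R) : block m n -> {set block m n} -> Prop :=
| stepII_stop (b : block m n) :
    (forall I, ~ admissible A r c b I) -> stepII A r c b [set b]
| stepII_split (b : block m n) (I : {set 'I_m}) (S1 S2 : {set block m n}) :
    admissible A r c b I ->
    stepII A r c (I, nbr A b.2 I) S1 ->
    stepII A r c (b.1 :\: I, b.2 :\: nbr A b.2 I) S2 ->
    stepII A r c b (S1 :|: S2).

(* Some execution of Step I on the whole matrix, followed by executions of
   Step II on all of the resulting blocks, outputs S. *)
Definition algorithm_output (R : realFieldType) (m n : nat) (A : 'M[R]_(m, n))
    (r : 'I_m -> R) (c : 'I_n -> R) (S : {set block m n}) : Prop :=
  exists (T : {set block m n}) (F : block m n -> {set block m n}),
    [/\ stepI A r c [set: 'I_m] [set: 'I_n] T,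
        forall b, b \in T -> stepII A r c b (F b) &
        S = \bigcup_(b in T) F b].

(* Main.v *)
(** Let lam j be the limit of the j-th column sum of B(k) divided by c j, and mu i
    the limit of the row factor by which row i is multiplied from C(k) to
    B(k + 1). The entry (i, j) is multiplied by a factor tending to mu i / lam j,
    so convergence forces mu i <= lam j wherever A i j <> 0, with equality
    wherever B i j <> 0. Counting the mass of B in the columns N(I) then
    identifies the blocks of Step I with the level sets of mu and lam, and the
    admissible sets of Step II with the unions of components of B that are
    closed under the support of A. In an unsplittable block, following the
    nonzero entries of A between components of B one can pass from any row to any
    other; every such move compares the accumulated row scaling factors, so these
    are all of the same order. Hence B and A have the same support in the block,
    and no proper union of components of B exists. *)

Require Import Defs.
From HB Require Import structures.
From mathcomp Require Import all_boot all_order all_algebra.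
From mathcomp Require Import boolp.

Set Implicit Arguments.
Unset Strict Implicit.
Unset Printing Implicit Defensive.

Import Order.TTheory GRing.Theory Num.Theory.

Local Open Scope ring_scope.

(** * Families of blocks with a component that partitions a set *)

Definition tiles (T U : finType) (f : U -> {set T}) (P : {set T})
    (S : {set U}) : Prop :=
  [/\ forall s, s \in S -> f s != set0,
      forall x, x \in P -> exists2 s, s \in S & x \in f s,
      forall s, s \in S -> f s \subset P &
      forall s t x, s \in S -> t \in S -> x \in f s -> x \in f t -> s = t].

Lemma disjointsD (T : finType) (P Q : {set T}) : [disjoint P & Q :\: P].
Proof. by rewrite -setI_eq0; apply/eqP/setP=> x; rewrite !inE; case: (x \in P). Qed.

Lemma setUDK (T : finType) (P Q : {set T}) : P \subset Q -> P :|: Q :\: P = Q.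
Proof. by move=> /setIidPr {1}<-; apply: setID. Qed.

Section Tiles.
Variables (T U : finType) (f : U -> {set T}).
Implicit Types (P : {set T}) (S : {set U}).

Lemma tiles0 : tiles f set0 set0.
Proof. by split=> [s|x|s|s t x]; rewrite ?inE. Qed.

Lemma tiles1 s : f s != set0 -> tiles f (f s) [set s].
Proof.
move=> fs0; split=> [t|x xs|t|t u x]; rewrite ?inE; try by move/eqP->.
- by exists s; rewrite ?set11.
- by move=> /eqP-> /eqP->.
Qed.

Lemma tilesU P1 P2 S1 S2 : [disjoint P1 & P2] -> tiles f P1 S1 ->
  tiles f P2 S2 -> tiles f (P1 :|: P2) (S1 :|: S2).
Proof.
move=> dis [n1 c1 s1 i1] [n2 c2 s2 i2].
have no x s t : s \in S1 -> t \in S2 -> x \in f s -> x \in f t -> False.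
  move=> sS tS xs xt; have := disjointFr dis (subsetP (s1 _ sS) _ xs).
  by rewrite (subsetP (s2 _ tS) _ xt).
split.
- by move=> s /setUP[/n1|/n2].
- by move=> x /setUP[/c1|/c2] [s sS xs]; exists s => //; rewrite inE sS ?orbT.
- by move=> s /setUP[/s1|/s2] /subset_trans; apply; rewrite ?subsetUl ?subsetUr.
- move=> s t x /setUP[sS|sS] /setUP[tS|tS] xs xt.
  + exact: i1 xs xt.
  + by case: (no _ _ _ sS tS xs xt).
  + by case: (no _ _ _ tS sS xt xs).
  + exact: i2 xs xt.
Qed.

Lemma tilesD1 P S s : tiles f P S -> s \in S -> tiles f (P :\: f s) (S :\ s).
Proof.
move=> [n1 c1 s1 i1] sS; split.
- by move=> t /setD1P[_ /n1].
- move=> x /setDP[xP xs]; have [t tS xt] := c1 _ xP; exists t => //.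
  by rewrite !inE tS andbT; apply: contraNneq xs => <-.
- move=> t /setD1P[ts tS]; apply/subsetP=> x xt.
  rewrite inE (subsetP (s1 _ tS) _ xt) andbT.
  by apply: contraNN ts => xs; apply/eqP; apply: i1 xt xs.
- by move=> t u x /setD1P[_ tS] /setD1P[_ uS]; apply: i1.
Qed.

Lemma tiles_bigcup P S (F : U -> {set U}) : tiles f P S ->
  (forall s, s \in S -> tiles f (f s) (F s)) ->
  tiles f P (\bigcup_(s in S) F s).
Proof.
move=> [n1 c1 s1 i1] tF; split.
- by move=> t /bigcupP[s /tF[+ _ _ _]]; apply.
- move=> x /c1[s sS]; case: (tF _ sS) => _ cF _ _ /cF[t tF' xt].
  by exists t => //; apply/bigcupP; exists s.
- move=> t /bigcupP[s sS]; case: (tF _ sS) => _ _ sF _ /sF /subset_trans; apply.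
  exact: s1.
- move=> t u x /bigcupP[s sS ts] /bigcupP[s' sS' us] xt xu.
  have [_ _ sF iF] := tF _ sS; have [_ _ sF' iF'] := tF _ sS'.
  have ss' : s = s'.
    exact: i1 (subsetP (sF _ ts) _ xt) (subsetP (sF' _ us) _ xu).
  by subst s'; apply: iF xt xu.
Qed.

(** Since the parts are nonempty, the last clause of [tiles] encodes disjointness and injectivity of
    [f] at once; unlike a partition of the image, it passes directly to unions and removals. *)
Lemma tiles_inj_partition S : {in S &, injective f} /\
  partition [set f b | b in S] [set: T] <-> tiles f [set: T] S.
Proof.
split=> [[finj /and3P[/eqP cov triv n0]]|[n1 c1 s1 i1]].
  split=> //.
  - by move=> s sS; apply: contraNneq n0 => <-; apply: imset_f.
  - move=> x _; have: x \in cover [set f b | b in S] by rewrite cov inE.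
    by move=> /bigcupP[_ /imsetP[s sS ->] xs]; exists s.
  - move=> s t x sS tS xs xt; apply: finj => //.
    apply: contraTeq xt => st.
    have /trivIsetP /(_ (f s) (f t)) := triv.
    by rewrite !imset_f // => /(_ isT isT st) /disjointFr ->.
have finj : {in S &, injective f}.
  move=> s t sS tS st; have /set0Pn[x xs] := n1 _ sS.
  by apply: (i1 _ _ x) => //; rewrite -st.
split=> //; apply/and3P; split.
- rewrite eqEsubset subsetT; apply/subsetP=> x /c1[s sS xs].
  by apply/bigcupP; exists (f s) => //; apply: imset_f.
- apply/trivIsetP=> _ _ /imsetP[s sS ->] /imsetP[t tS ->] st.
  rewrite -setI_eq0; apply: contraNT st => /set0Pn[x /setIP[xs xt]].
  by rewrite (i1 _ _ _ sS tS xs xt).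
- by apply/imsetP=> -[s /n1 + E]; rewrite -E eqxx.
Qed.

End Tiles.

Lemma is_splittingP (m n : nat) (S : {set block m n}) :
  is_splitting S <-> tiles fst [set: 'I_m] S /\ tiles snd [set: 'I_n] S.
Proof.
rewrite -!tiles_inj_partition.
by split=> [[*]|[[? ?] [? ?]]]; split.
Qed.

(** * Refinement of splittings *)

Lemma refines_trans (m n : nat) (S T U : {set block m n}) :
  refines S T -> refines T U -> refines S U.
Proof.
move=> ST; elim=> // V b b1 b2 _ SV bV h1 h2; exact: refines_step h1 h2.
Qed.

(** Induction on the number of blocks of [S] missing from [T]: a missing block [s] lies in a block
    [t] of [T], which is replaced by [s] and the remainder [u]. *)
Lemma refines_finer (m n : nat) (S T : {set block m n}) :
  is_splitting S -> is_splitting T ->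
  (forall s, s \in S -> exists t, [/\ t \in T, s.1 \subset t.1 & s.2 \subset t.2]) ->
  refines T S.
Proof.
move=> /is_splittingP[[n1 c1 _ i1] [n2 c2 _ i2]].
have [k] := ubnP #|S :\: T|; elim: k => // k IH in T * => le_k.
move=> /is_splittingP[tT1 tT2] fin.
have [m1 d1 _ k1] := tT1; have [m2 d2 _ k2] := tT2.
have [|/set0Pn[s /setDP[sS sT]]] := boolP (S :\: T == set0).
  rewrite setD_eq0 => ST; suff <- : S = T by apply: refines_refl.
  apply/eqP; rewrite eqEsubset ST; apply/subsetP => t tT.
  have /set0Pn[x xt] := m1 _ tT; have [s sS xs] := c1 x (in_setT x).
  by rewrite -(k1 _ _ _ (subsetP ST _ sS) tT xs xt).
have [t [tT st1 st2]] := fin _ sS.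
have in_t1 s' x : s' \in S -> x \in s'.1 -> x \in t.1 ->
    s'.1 \subset t.1 /\ s'.2 \subset t.2.
  move=> s'S xs' xt; have [t' [t'T h1 h2]] := fin _ s'S.
  by rewrite (k1 _ _ _ tT t'T xt (subsetP h1 _ xs')).
have in_t2 s' x : s' \in S -> x \in s'.2 -> x \in t.2 ->
    s'.1 \subset t.1 /\ s'.2 \subset t.2.
  move=> s'S xs' xt; have [t' [t'T h1 h2]] := fin _ s'S.
  by rewrite (k2 _ _ _ tT t'T xt (subsetP h2 _ xs')).
pose u : block m n := (t.1 :\: s.1, t.2 :\: s.2).
have st : s != t by apply: contraNneq sT => ->.
(* A block of [S] meeting [t] lies inside [t]; if [s] fills the rows of [t], that block shares a row
   with [s] and equals it. So the remainder is empty in one component only if [t] is [s]. *)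
have eq12 : t.1 \subset s.1 -> t.2 \subset s.2.
  move=> ts; apply/subsetP=> y yt; have [s' s'S ys'] := c2 y (in_setT y).
  have [h1 _] := in_t2 _ _ s'S ys' yt; have /set0Pn[x xs'] := n1 _ s'S.
  by rewrite -(i1 _ _ _ s'S sS xs' (subsetP ts _ (subsetP h1 _ xs'))).
have eq21 : t.2 \subset s.2 -> t.1 \subset s.1.
  move=> ts; apply/subsetP=> y yt; have [s' s'S ys'] := c1 y (in_setT y).
  have [_ h1] := in_t1 _ _ s'S ys' yt; have /set0Pn[x xs'] := n2 _ s'S.
  by rewrite -(i2 _ _ _ s'S sS xs' (subsetP ts _ (subsetP h1 _ xs'))).
have neq : ~ (t.1 \subset s.1 /\ t.2 \subset s.2).
  move=> [h1 h2]; case/negP: st; rewrite -pair_eqE /pair_eq !eqEsubset.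
  by rewrite h1 h2 st1 st2.
have u1 : u.1 != set0 by rewrite setD_eq0; apply/negP=> h; apply: neq; auto.
have u2 : u.2 != set0 by rewrite setD_eq0; apply/negP=> h; apply: neq; auto.
pose T' := [set s; u] :|: (T :\ t).
have TT' : refines T T'.
  by apply: (refines_step (b := t)) => //; [exact: refines_refl| |]; split;
    rewrite ?setUDK ?disjointsD // ?n1 ?n2.
apply: (refines_trans TT'); apply: IH.
- rewrite -ltnS; apply: leq_trans le_k; rewrite ltnS; apply: proper_card.
  apply/properP; split; last by exists s; rewrite ?inE ?sS ?sT ?eqxx.
  apply/subsetP=> x /setDP[xS]; rewrite !inE xS andbT.
  apply: contraNN => xT; apply/orP; right; rewrite xT andbT.
  (* The removed block [t] is not in [S], as it would share a row with [s]; hence no block of [S]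
     already reached is lost. *)
  apply: contraNneq sT => xt; have /set0Pn[y ys] := n1 _ sS.
  suff -> : s = x by [].
  by apply: (i1 _ _ y) => //; rewrite xt (subsetP st1).
- apply/is_splittingP; rewrite -(setUDK (subsetT t.1)).
  rewrite -(setUDK (subsetT t.2)); split.
  + apply: (tilesU (disjointsD _ _)); last exact: tilesD1.
    rewrite -(setUDK st1); apply: (tilesU (disjointsD _ _)).
      exact/tiles1/n1.
    exact: (tiles1 (f := fst) (s := u)).
  + apply: (tilesU (disjointsD _ _)); last exact: tilesD1.
    rewrite -(setUDK st2); apply: (tilesU (disjointsD _ _)).
      exact/tiles1/n2.
    exact: (tiles1 (f := snd) (s := u)).
- move=> s' s'S; have [t' [t'T h1 h2]] := fin _ s'S.
  have [tt'|tt'] := eqVneq t' t; last by exists t'; rewrite !inE t'T tt' orbT.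
  have [->|ss'] := eqVneq s' s; first by exists s; rewrite !inE eqxx.
  subst t'; exists u; split; first by rewrite !inE eqxx orbT.
    apply/subsetP=> x xs'; rewrite inE (subsetP h1 _ xs') andbT.
    by apply: contraNN ss' => xs; rewrite (i1 _ _ _ s'S sS xs' xs).
  apply/subsetP=> x xs'; rewrite inE (subsetP h2 _ xs') andbT.
  by apply: contraNN ss' => xs; rewrite (i2 _ _ _ s'S sS xs' xs).
Qed.

(** * The algorithm analysed from abstract properties of the limit *)

Section LimitBlocks.
Variables (R : realFieldType) (m n : nat).
Variables (A : 'M[R]_(m, n)) (r : 'I_m -> R) (c : 'I_n -> R).
Variables (B : 'M[R]_(m, n)) (mu : 'I_m -> R) (lam : 'I_n -> R).
(** Abstract growth comparison, later instantiated by: the accumulated row factor of the first row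
    is eventually at most a constant times that of the second. *)
Variable (dom : 'I_m -> 'I_m -> Prop).
Hypotheses (r_gt0 : forall i, 0 < r i) (c_gt0 : forall j, 0 < c j).
Hypotheses (B_ge0 : forall i j, 0 <= B i j)
  (supp_BA : forall i j, B i j != 0 -> A i j != 0).
Hypotheses (B_row : forall i, \sum_j B i j = r i)
  (B_col : forall j, \sum_i B i j = lam j * c j).
Hypothesis lam_gt0 : forall j, 0 < lam j.
Hypotheses (mu_eq : forall i j, B i j != 0 -> mu i = lam j)
  (mu_le : forall i j, A i j != 0 -> mu i <= lam j).
Hypotheses (dom_refl : forall i, dom i i)
  (dom_trans : forall i k l, dom i k -> dom k l -> dom i l)
  (dom_edge : forall i k j, A i j != 0 -> B k j != 0 -> dom i k)
  (dom_supp : forall i k j, dom k i -> A i j != 0 -> B k j != 0 -> B i j != 0).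

Implicit Types (P I K : {set 'I_m}) (Q L : {set 'I_n}) (b : block m n).

(** No edge of the support of [B] leaves the block: these are the unions of connected components of
    [B], the empty one included. *)
Definition saturated b := forall i j, B i j != 0 -> (i \in b.1) = (j \in b.2).

Lemma ex_supp_row i : exists j, B i j != 0.
Proof.
apply/existsP; apply: contraT; rewrite negb_exists => /forallP h.
have := r_gt0 i; rewrite -B_row big1 ?ltxx // => j _.
by apply/eqP; have := h j; rewrite negbK.
Qed.

Lemma ex_supp_col j : exists i, B i j != 0.
Proof.
apply/existsP; apply: contraT; rewrite negb_exists => /forallP h.
have := mulr_gt0 (lam_gt0 j) (c_gt0 j); rewrite -B_col big1 ?ltxx // => i _.
by apply/eqP; have := h i; rewrite negbK.
Qed.

(** Every row and column carries mass of [B]. This is why Step I runs out of rows and columns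
    simultaneously. *)
Lemma saturated_neq0 b : saturated b -> (b.1 != set0) = (b.2 != set0).
Proof.
move=> sat; apply/set0Pn/set0Pn => [[i ib]|[j jb]].
  by have [j Bij] := ex_supp_row i; exists j; rewrite -(sat _ _ Bij).
by have [i Bij] := ex_supp_col j; exists i; rewrite (sat _ _ Bij).
Qed.

Lemma saturatedD b b' : saturated b -> saturated b' ->
  saturated (b.1 :\: b'.1, b.2 :\: b'.2).
Proof. by move=> h h' i j Bij; rewrite !inE (h _ _ Bij) (h' _ _ Bij). Qed.

(** The rows of [K] send their whole mass into [L]; the last sum is the mass that [L] receives from
    other rows. *)
Lemma mass_split K L : (forall i j, B i j != 0 -> i \in K -> j \in L) ->
  \sum_(j in L) lam j * c j =
  sumset r K + \sum_(j in L) \sum_(i | i \notin K) B i j.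
Proof.
move=> KL; rewrite /sumset.
have -> : \sum_(i in K) r i = \sum_(j in L) \sum_(i in K) B i j.
  rewrite exchange_big /=; apply: eq_bigr => i iK.
  rewrite -B_row (bigID (mem L)) /= [X in _ + X]big1 ?addr0 // => j jL.
  by apply/eqP; apply: contraNT jL => /KL; apply.
rewrite -big_split /=; apply: eq_bigr => j _.
by rewrite -B_col (bigID (mem K)).
Qed.

Lemma mass_saturated b : saturated b ->
  sumset r b.1 = \sum_(j in b.2) lam j * c j.
Proof.
move=> sat; rewrite (mass_split (K := b.1)) => [|i j /sat->] //.
rewrite [X in _ + X]big1 ?addr0 // => j jb; apply: big1 => i ib.
by apply/eqP; apply: contraNT ib => /sat ->.
Qed.

(** The mass received from outside rows is a sum of nonnegative entries, so the inequality forces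
    each of them to vanish. *)
Lemma mass_eq_saturated b :
  (forall i j, B i j != 0 -> i \in b.1 -> j \in b.2) ->
  \sum_(j in b.2) lam j * c j <= sumset r b.1 -> saturated b.
Proof.
move=> sub; rewrite (mass_split sub) gerDl => le0 i j Bij.
apply/idP/idP; first exact: sub.
move=> jb; apply: contraT => ib.
have ge0 j' : 0 <= \sum_(i' | i' \notin b.1) B i' j' by apply: sumr_ge0.
suff: 0 < \sum_(j' in b.2) \sum_(i' | i' \notin b.1) B i' j'.
  by rewrite ltNge le0.
rewrite (bigD1 j) //=; apply: ltr_pwDl; last exact: sumr_ge0.
rewrite (bigD1 i) //=; apply: ltr_pwDl; last exact: sumr_ge0.
by rewrite lt0r Bij B_ge0.
Qed.

Lemma supp_nbr b I i j : saturated b -> I \subset b.1 -> B i j != 0 ->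
  i \in I -> j \in nbr A b.2 I.
Proof.
move=> sat sub Bij iI; rewrite inE -(sat _ _ Bij) (subsetP sub _ iI) /=.
by apply/existsP; exists i; rewrite iI supp_BA.
Qed.

Lemma sumset_c_gt0 L : L != set0 -> 0 < sumset c L.
Proof.
move=> /set0Pn[j jL]; rewrite /sumset (bigD1 j) //=.
by apply: ltr_pwDl => //; apply: sumr_ge0 => k _; apply: ltW.
Qed.

Lemma nbr_neq0 b I : saturated b -> I \subset b.1 -> I != set0 ->
  nbr A b.2 I != set0.
Proof.
move=> sat sub /set0Pn[i iI]; have [j Bij] := ex_supp_row i.
by apply/set0Pn; exists j; apply: supp_nbr iI.
Qed.

(** * The top level set and the set phi *)

Section Level.
Variables (b : block m n) (l : R).
Hypotheses (sat : saturated b) (le_l : forall j, j \in b.2 -> lam j <= l).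
Let top : block m n :=
  ([set i in b.1 | mu i == l], [set j in b.2 | lam j == l]).

(** A neighbour of a row with [mu i = l] has [lam j >= l] by [mu_le], and [l] is an upper bound;
    conversely, a column with [lam j = l] carries mass from a row with [mu i = l]. *)
Lemma nbr_level : nbr A b.2 top.1 = top.2.
Proof.
apply/setP=> j; rewrite !inE; case jb: (j \in b.2) => //=.
apply/existsP/eqP => [[i]|lj].
  rewrite inE => /andP[/andP[ib /eqP mi] Aij].
  by apply/eqP; rewrite eq_le le_l // -mi mu_le.
have [i Bij] := ex_supp_col j; exists i.
by rewrite inE (sat Bij) jb (mu_eq Bij) lj eqxx supp_BA.
Qed.

Lemma saturated_level : saturated top.
Proof. by move=> i j Bij; rewrite !inE (sat Bij) (mu_eq Bij). Qed.

(** The mass of [B] in N(K) is at least r(K) and at most l c(N(K)). Equality forces [lam j = l] on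
    N(K), hence [mu i = l] on [K]. The second conjunct of the condition reduces the equality case to
    this implication. *)
Lemma ratio_le_level K : K != set0 -> K \subset b.1 ->
  Defs.ratio A r c b.2 K <= l ?= iff (K \subset top.1) && (Defs.ratio A r c b.2 K == l).
Proof.
move=> K0 Kb; have cN := sumset_c_gt0 (nbr_neq0 sat Kb K0).
have KN i j := @supp_nbr b K i j sat Kb.
have le1 : sumset r K <= \sum_(j in nbr A b.2 K) lam j * c j.
  rewrite (mass_split KN) lerDl; apply: sumr_ge0 => j _; exact: sumr_ge0.
have le2 : \sum_(j in nbr A b.2 K) lam j * c j <= l * sumset c (nbr A b.2 K).
  rewrite mulr_sumr; apply: ler_sum => j; rewrite inE => /andP[jb _].
  by rewrite ler_pM2r // le_l.
split; first by rewrite ler_pdivrMr // (le_trans le1).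
apply/eqP/andP => [E|[_ /eqP] //]; split; last by rewrite E.
have {E} E : sumset r K = l * sumset c (nbr A b.2 K).
  by rewrite -E /Defs.ratio divfK // gt_eqF.
have E2 : \sum_(j in nbr A b.2 K) lam j * c j = l * sumset c (nbr A b.2 K).
  by apply/le_anti; rewrite le2 /= -E.
apply/subsetP=> i iK; rewrite inE (subsetP Kb _ iK) /=.
have [j Bij] := ex_supp_row i; have jN := KN _ _ Bij iK.
rewrite (mu_eq Bij) eq_le le_l /=; last by rewrite -(sat Bij) (subsetP Kb).
rewrite leNgt; apply/negP => lt_l.
suff: \sum_(j in nbr A b.2 K) lam j * c j < l * sumset c (nbr A b.2 K).
  by rewrite E2 ltxx.
rewrite mulr_sumr (bigD1 j) //= [ltRHS](bigD1 j) //=.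
apply: ltr_leD; first by rewrite ltr_pM2r.
apply: ler_sum => k /andP[]. rewrite inE => /andP[kb _] _.
by rewrite ler_pM2r // le_l.
Qed.

Lemma sumset_level : sumset r top.1 = l * sumset c top.2.
Proof.
rewrite (mass_saturated saturated_level) mulr_sumr.
by apply: eq_bigr => j; rewrite inE => /andP[_ /eqP->].
Qed.

Hypothesis ex_l : exists2 i, i \in b.1 & mu i = l.

Lemma level_neq0 : top.1 != set0.
Proof.
by case: ex_l => i ib mi; apply/set0Pn; exists i; rewrite inE ib mi eqxx.
Qed.

Lemma level_sub : top.1 \subset b.1.
Proof. by apply/subsetP=> i; rewrite inE => /andP[]. Qed.

Lemma ratio_level : Defs.ratio A r c b.2 top.1 = l.
Proof.
rewrite /Defs.ratio nbr_level sumset_level mulfK // gt_eqF // sumset_c_gt0 //.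
by rewrite -(saturated_neq0 saturated_level) level_neq0.
Qed.

(** The top rows attain the bound [l] and contain every other maximizer, so they are the largest
    one. *)
Lemma is_phi_level I : is_phi A r c b.1 b.2 I <-> I = top.1.
Proof.
split=> [[I0 Ib max1 max2]|->].
  have E : Defs.ratio A r c b.2 I = l.
    apply/le_anti; rewrite (ratio_le_level I0 Ib).
    by rewrite -[X in X <= _]ratio_level max1 // ?level_neq0 ?level_sub.
  have [_] := ratio_le_level I0 Ib; rewrite E eqxx andbT => sub.
  apply/eqP; rewrite eqEcard -sub max2 ?level_neq0 ?level_sub //.
  by rewrite E ratio_level.
split; rewrite ?level_neq0 ?level_sub // => K K0 Kb; rewrite ratio_level.
  exact: ratio_le_level.
move=> E; have [_] := ratio_le_level K0 Kb; rewrite E eqxx andbT => sub.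
by apply: subset_leq_card; rewrite -sub.
Qed.

End Level.

(** * Executions of Step I and Step II *)

Definition level_block b (l : R) :=
  [/\ saturated b, b.1 != set0 & forall j, j \in b.2 -> lam j = l].

Lemma ex_phi b : saturated b -> b.1 != set0 -> exists I l,
  level_block (I, nbr A b.2 I) l /\ (forall K, is_phi A r c b.1 b.2 K <-> K = I).
Proof.
move=> sat /set0Pn[i0 i0b].
case: (arg_maxP mu i0b) => i ib maxi.
(* The maximum of [mu] also bounds [lam], since each column of [b] carries mass from a row of [b],
   where the two agree. *)
have le_l j : j \in b.2 -> lam j <= mu i.
  have [k Bkj] := ex_supp_col j; rewrite -(sat _ _ Bkj) -(mu_eq Bkj).
  exact: maxi.
have ex_l : exists2 i', i' \in b.1 & mu i' = mu i by exists i.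
exists [set k in b.1 | mu k == mu i], (mu i).
rewrite (nbr_level sat le_l); split; last exact: (is_phi_level sat le_l ex_l).
split; [exact: saturated_level | exact: (level_neq0 ex_l) |].
by move=> j; rewrite inE => /andP[_ /eqP].
Qed.

Lemma ex_stepI P Q : saturated (P, Q) -> exists S, stepI A r c P Q S.
Proof.
have [k] := ubnP #|P|; elim: k => // k IH in P Q * => le_k sat.
have [P0|P0] := eqVneq P set0.
  have /= := saturated_neq0 sat; rewrite P0 eqxx => /esym/negbFE/eqP->.
  by exists set0; exact: stepI_stop.
have [I [l [[satI I0 _] phiI]]] := ex_phi sat P0.
have [_ IP _ _] := (phiI I).2 erefl.
have [||S IS] := IH (P :\: I) (Q :\: nbr A Q I).
- rewrite -ltnS; apply: leq_trans le_k; rewrite ltnS cardsD (setIidPr IP).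
  by rewrite ltn_subrL !card_gt0 I0 P0.
- exact: (saturatedD sat satI).
exists ((I, nbr A Q I) |: S); apply: stepI_next => //; last exact/phiI.
by rewrite -(saturated_neq0 sat).
Qed.

(** The top level set is saturated, so what remains after deleting it is saturated and the next
    round again selects a level set. *)
Lemma stepI_blocks P Q S : saturated (P, Q) -> stepI A r c P Q S ->
  [/\ tiles fst P S, tiles snd Q S &
      forall b, b \in S -> exists l, level_block b l].
Proof.
move=> + PQS; elim: PQS => {P Q S} [_|P Q I S P0 Q0 phi _ IH sat].
  by split; rewrite ?inE //; [exact: tiles0 | exact: tiles0 | move=> b; rewrite inE].
have [I' [l [lev phiI]]] := ex_phi sat P0; have /phiI E := phi; subst I'.
have [satI I0 _] := lev; have [_ IP _ _] := phi.
have [t1 t2 levS] := IH (saturatedD sat satI).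
have NQ : nbr A Q I \subset Q by apply/subsetP=> j; rewrite inE => /andP[].
split.
- rewrite -(setUDK IP); apply: tilesU t1; first exact: disjointsD.
  exact: (tiles1 (f := fst) (s := (I, nbr A Q I))).
- rewrite -[X in tiles _ X](setUDK NQ); apply: tilesU t2; first exact: disjointsD.
  have N0 : nbr A Q I != set0 by rewrite -(saturated_neq0 satI).
  exact: (tiles1 (f := snd) (s := (I, nbr A Q I))).
- by move=> b /setU1P[->|/levS //]; exists l.
Qed.

Lemma ex_stepII b : exists S, stepII A r c b S.
Proof.
have [k] := ubnP #|b.1|; elim: k => // k IH in b * => le_k.
have [[I adm]|none] := pselect (exists I, admissible A r c b I); last first.
  by exists [set b]; apply: stepII_stop => I adm; apply: none; exists I.
have [I0 Ib _] := adm.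
have [|S1 h1] := IH (I, nbr A b.2 I).
  by rewrite -ltnS; apply: leq_trans le_k; exact: proper_card.
have [|S2 h2] := IH (b.1 :\: I, b.2 :\: nbr A b.2 I).
  rewrite -ltnS; apply: leq_trans le_k; rewrite ltnS /= cardsD (setIidPr (proper_sub Ib)).
  by rewrite ltn_subrL (leq_ltn_trans _ (proper_card Ib)) // card_gt0 I0.
by exists (S1 :|: S2); exact: stepII_split adm h1 h2.
Qed.

Lemma sumset_level_block b l : level_block b l ->
  sumset r b.1 = l * sumset c b.2.
Proof.
move=> [sat _ lev]; rewrite (mass_saturated sat) mulr_sumr.
by apply: eq_bigr => j /lev ->.
Qed.

(** On a level block r(P)/c(Q) is [l], and l c(N(I)) is the mass of [B] in the columns N(I). The
    equation of Step II thus says that these columns receive nothing from outside [I]. *)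
Lemma admissibleP b l I : level_block b l ->
  admissible A r c b I <->
  [/\ I != set0, I \proper b.1 & saturated (I, nbr A b.2 I)].
Proof.
move=> lev; have [sat b0 levb] := lev.
have b20 : b.2 != set0 by rewrite -(saturated_neq0 sat).
have sumN : l * sumset c (nbr A b.2 I) = \sum_(j in nbr A b.2 I) lam j * c j.
  by rewrite mulr_sumr; apply: eq_bigr => j; rewrite inE => /andP[/levb ->].
rewrite /admissible (sumset_level_block lev) mulfK ?gt_eqF ?sumset_c_gt0 //.
split=> [[I0 Ib E]|[I0 Ib satI]]; split=> //.
  apply: mass_eq_saturated => [i j Bij iI /=|].
    exact: supp_nbr (proper_sub Ib) Bij iI.
  by rewrite /= E sumN.
by rewrite sumN -(mass_saturated satI).
Qed.

(** Both halves of an admissible split are saturated and inherit the level [l], so the recursion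
    stays within level blocks. *)
Lemma stepII_blocks b l S : level_block b l -> stepII A r c b S ->
  [/\ tiles fst b.1 S, tiles snd b.2 S &
      forall b', b' \in S -> exists l, level_block b' l /\
        forall I, ~ admissible A r c b' I].
Proof.
move=> + bS; elim: bS => {b S} [b none lev|b I S1 S2 adm _ IH1 _ IH2 lev].
  have [sat b0 _] := lev; split.
  - exact: tiles1.
  - by apply: tiles1; rewrite -(saturated_neq0 sat).
  - by move=> b' /set1P->; exists l.
have [sat b0 levb] := lev; have /(admissibleP I lev)[I0 Ib satI] := adm.
have NQ : nbr A b.2 I \subset b.2 by apply/subsetP=> j; rewrite inE => /andP[].
have [|s1 s2 s3] := IH1.
  by split=> // j /(subsetP NQ)/levb.
have [|t1 t2 t3] := IH2.
  split; first exact: (saturatedD sat satI).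
    by rewrite setD_eq0 proper_subn.
  by move=> j /setDP[/levb].
split.
- by rewrite -(setUDK (proper_sub Ib)); apply: tilesU; rewrite ?disjointsD.
- by rewrite -[X in tiles _ X](setUDK NQ); apply: tilesU; rewrite ?disjointsD.
- by move=> b' /setUP[/s3|/t3].
Qed.

(* The rows dominating a given row form an admissible set or the whole block, so
   all rows of an unsplittable block dominate each other. *)
Lemma unsplittable_supp b l i j : level_block b l ->
  (forall I, ~ admissible A r c b I) ->
  i \in b.1 -> j \in b.2 -> A i j != 0 -> B i j != 0.
Proof.
move=> lev none ib jb Aij; have [sat _ _] := lev.
have [k Bkj] := ex_supp_col j; apply: (dom_supp _ Aij Bkj).
have kb : k \in b.1 by rewrite (sat _ _ Bkj).
pose I := [set i' in b.1 | `[< dom k i' >]].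
have kI : k \in I by rewrite inE kb; apply/asboolP.
have Ib : I \subset b.1 by apply/subsetP=> i'; rewrite inE => /andP[].
suff: i \in I by rewrite inE => /andP[_ /asboolP].
have [bI|nbI] := boolP (b.1 \subset I); first exact: (subsetP bI).
case: (none I); apply/(admissibleP I lev); split.
- by apply/set0Pn; exists k.
- by rewrite properE Ib.
move=> i' j' Bij' /=; apply/idP/idP; first exact: supp_nbr Bij'.
(* A column of N(I) has a neighbour [k'] in [I]; its mass in row [i'] gives [dom k' i'], and
   transitivity puts [i'] into [I]. *)
rewrite !inE => /andP[jb' /existsP[k' /andP[]]].
rewrite inE => /andP[_ /asboolP dk'] Ak'; rewrite (sat _ _ Bij') jb' /=.
by apply/asboolP; exact: dom_trans (dom_edge Ak' Bij').
Qed.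

(** * Comparison of unsplittable blocks with other splittings *)

(** Within [b] the supports of [A] and [B] coincide, so N of the rows common to [b] and [b'] stays
    in [b']. If these rows did not exhaust [b], they would be admissible. *)
Lemma unsplittable_sub b b' l i : level_block b l ->
  (forall I, ~ admissible A r c b I) -> saturated b' ->
  i \in b.1 -> i \in b'.1 -> (b.1 \subset b'.1) /\ (b.2 \subset b'.2).
Proof.
move=> lev none sat' ib ib'; have [sat _ _] := lev.
have sub1 : b.1 \subset b'.1.
  rewrite -[_ \subset _]negbK; apply/negP=> nsub.
  case: (none (b.1 :&: b'.1)); apply/(admissibleP _ lev); split.
  - by apply/set0Pn; exists i; rewrite inE ib.
  - by rewrite properE subsetIl subsetI subxx.
  move=> i' j Bij; rewrite /= inE; apply/idP/idP.
    by move=> iI; apply: supp_nbr (subsetIl _ _) Bij _; rewrite // inE.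
  rewrite inE => /andP[jb /existsP[k /andP[/setIP[kb kb'] Akj]]].
  have Bkj := unsplittable_supp lev none kb jb Akj.
  by rewrite (sat _ _ Bij) jb (sat' _ _ Bij) -(sat' _ _ Bkj).
split=> //; apply/subsetP=> j jb; have [k Bkj] := ex_supp_col j.
by rewrite -(sat' _ _ Bkj) (subsetP sub1) // (sat _ _ Bkj).
Qed.

Lemma splitting_saturated T : is_splitting T -> covers_support B T ->
  forall t, t \in T -> saturated t.
Proof.
move=> /is_splittingP[[_ _ _ k1] [_ _ _ k2]] cov t tT i j Bij.
have [t' t'T /andP[it jt]] := cov _ _ Bij.
apply/idP/idP => h.
  by rewrite (k1 _ _ _ tT t'T h it).
by rewrite (k2 _ _ _ tT t'T h jt).
Qed.

Lemma ex_algorithm_output : exists S, algorithm_output A r c S.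
Proof.
have [|T hT] := @ex_stepI setT setT; first by move=> i j _; rewrite !inE.
have [F hF] := choice ex_stepII.
by exists (\bigcup_(b in T) F b), T, F.
Qed.

(** Output blocks are saturated, hence cover the support. Blocks of any other covering splitting are
    saturated too, and an unsplittable block lies inside each of them that it meets in a row. *)
Lemma algorithm_output_decomposition S :
  algorithm_output A r c S -> is_decomposition B S.
Proof.
move=> [T [F [hT hF ->]]].
have [|t1 t2 levT] := stepI_blocks _ hT; first by move=> i j _; rewrite !inE.
set U := \bigcup_(b in T) F b.
have levU b : b \in U -> exists l, level_block b l /\
    forall I, ~ admissible A r c b I.
  move=> /bigcupP[t tT]; have [l /stepII_blocks/(_ (hF _ tT))[_ _]] := levT _ tT.
  by apply.
have u1 : tiles fst setT U.
  apply: tiles_bigcup t1 _ => t tT.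
  by have [l /stepII_blocks/(_ (hF _ tT))[]] := levT _ tT.
have u2 : tiles snd setT U.
  apply: tiles_bigcup t2 _ => t tT.
  by have [l /stepII_blocks/(_ (hF _ tT))[]] := levT _ tT.
have splU : is_splitting U by apply/is_splittingP.
split=> //.
  move=> i j Bij; have [_ /(_ i (in_setT i))[b bU ib] _ _] := u1.
  exists b => //; rewrite ib /=; have [l [[sat _ _] _]] := levU _ bU.
  by rewrite -(sat _ _ Bij).
move=> V splV covV; apply: refines_finer => // b bU.
have [l [lev none]] := levU _ bU; have [_ /set0Pn[i ib] _] := lev.
have /is_splittingP[[_ /(_ i (in_setT i))[v vV iv] _ _] _] := splV.
exists v; have [] := unsplittable_sub lev none _ ib iv => //.
exact: splitting_saturated vV.
Qed.

End LimitBlocks.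

From mathcomp Require Import all_classical all_reals all_analysis.
From mathcomp Require Import ring.
Import numFieldNormedType.Exports.

(** * The iterates as diagonal scalings of the initial matrix *)

Section Iterates.
Local Open Scope classical_set_scope.
Variables (R : realType) (m n : nat).
Variables (A : 'M[R]_(m, n)) (r : 'I_m -> R) (c : 'I_n -> R).
Hypotheses (A_ge0 : forall i j, 0 <= A i j)
  (A_row : forall i, exists j, A i j != 0)
  (A_col : forall j, exists i, A i j != 0)
  (r_gt0 : forall i, 0 < r i) (c_gt0 : forall j, 0 < c j).

(** The pair [xy] holds accumulated row and column factors; their positivity gives every iterate the
    support of [A]. *)
Definition scaling_of (M : 'M[R]_(m, n)) (xy : ('I_m -> R) * ('I_n -> R)) :=
  [/\ forall i, 0 < xy.1 i, forall j, 0 < xy.2 j &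
      forall i j, M i j = xy.1 i * A i j * xy.2 j].

Section ScalingOf.
Variables (M : 'M[R]_(m, n)) (xy : ('I_m -> R) * ('I_n -> R)).
Hypothesis Mxy : scaling_of M xy.

Lemma scaling_of_ge0 i j : 0 <= M i j.
Proof. by have [x0 y0 ->] := Mxy; rewrite !mulr_ge0 // ltW. Qed.

Lemma scaling_of_gt0 i j : A i j != 0 -> 0 < M i j.
Proof.
move=> Aij; have [x0 y0 ME] := Mxy.
by rewrite lt0r scaling_of_ge0 andbT ME !mulf_neq0 // gt_eqF.
Qed.

Lemma scaling_of_row_gt0 i : 0 < \sum_j M i j.
Proof.
have [j Aij] := A_row i; rewrite (bigD1 j) //=; apply: ltr_pwDl.
  exact: scaling_of_gt0.
by apply: sumr_ge0 => k _; apply: scaling_of_ge0.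
Qed.

Lemma scaling_of_col_gt0 j : 0 < \sum_i M i j.
Proof.
have [i Aij] := A_col j; rewrite (bigD1 i) //=; apply: ltr_pwDl.
  exact: scaling_of_gt0.
by apply: sumr_ge0 => k _; apply: scaling_of_ge0.
Qed.

Lemma scaling_of_row_scale :
  scaling_of (row_scale r M) (fun i => r i / (\sum_k M i k) * xy.1 i, xy.2).
Proof.
have [x0 y0 ME] := Mxy; split=> //= [i|i j].
  by rewrite mulr_gt0 // divr_gt0 // scaling_of_row_gt0.
by rewrite mxE ME !mulrA.
Qed.

Lemma scaling_of_col_scale :
  scaling_of (col_scale c M) (xy.1, fun j => xy.2 j * (c j / (\sum_k M k j))).
Proof.
have [x0 y0 ME] := Mxy; split=> //= [j|i j].
  by rewrite mulr_gt0 // divr_gt0 // scaling_of_col_gt0.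
by rewrite mxE ME !mulrA.
Qed.

Lemma row_scale_row i : \sum_j row_scale r M i j = r i.
Proof.
under eq_bigr do rewrite mxE.
by rewrite -mulr_sumr divfK // gt_eqF // scaling_of_row_gt0.
Qed.

Lemma col_scale_col j : \sum_i col_scale c M i j = c j.
Proof.
under eq_bigr do rewrite mxE.
by rewrite -mulr_suml mulrC divfK // gt_eqF // scaling_of_col_gt0.
Qed.

(* The smallest ratio between actual and prescribed column sums does not
   decrease along the procedure. *)
Lemma col_ratio_lower_bound (t : R) : 0 < t ->
  (forall i, \sum_j M i j = r i) -> (forall j, t * c j <= \sum_i M i j) ->
  forall j, t * c j <= \sum_i row_scale r (col_scale c M) i j.
Proof.
move=> t0 Mr tM j; rewrite -(col_scale_col j) mulr_sumr; apply: ler_sum => i _.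
have C0 := scaling_of_col_scale.
have Cge0 k : 0 <= col_scale c M i k.
  by rewrite mxE mulr_ge0 ?scaling_of_ge0 // divr_ge0 ?ltW // scaling_of_col_gt0.
have Crow : 0 < \sum_k col_scale c M i k.
  have [k Aik] := A_row i; rewrite (bigD1 k) //=; apply: ltr_pwDl.
    by rewrite mxE mulr_gt0 ?scaling_of_gt0 // divr_gt0 // scaling_of_col_gt0.
  by apply: sumr_ge0 => k' _.
(* Column factors are at most [1 / t], so row sums after column scaling are at most [r i / t] and
   the next row factors are at least [t]. *)
rewrite [leRHS]mxE ler_wpM2r // ler_pdivlMr // -Mr mulr_sumr; apply: ler_sum => k _.
rewrite mxE mulrCA ler_piMr ?scaling_of_ge0 // mulrA.
by rewrite ler_pdivrMr ?mul1r // scaling_of_col_gt0.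
Qed.

End ScalingOf.

Lemma ex_scaling_of_ispB k : exists xy, scaling_of (ispB A r c k) xy.
Proof.
elim: k => [|k [xy IH]] /=; eexists.
  by apply: (@scaling_of_row_scale _ (fun=> 1, fun=> 1)); split=> // i j; rewrite mul1r mulr1.
exact: scaling_of_row_scale (scaling_of_col_scale IH).
Qed.

Lemma ispB_row k i : \sum_j ispB A r c k i j = r i.
Proof.
case: k => [|k] /=.
  apply: (@row_scale_row _ (fun=> 1, fun=> 1)).
  by split=> // i' j; rewrite mul1r mulr1.
have [xy h] := ex_scaling_of_ispB k.
exact: row_scale_row (scaling_of_col_scale h) _.
Qed.

(** A bound uniform in [k] survives the limit and keeps the column sums of [B] positive. *)
Lemma ispB_col_lower_bound :
  exists2 t : R, 0 < t & forall k j, t * c j <= \sum_i ispB A r c k i j.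
Proof.
have [xy0 h0] := ex_scaling_of_ispB 0.
(* The smallest initial column ratio, capped by 1, which is the value when there are no columns. *)
pose t : R := \big[Num.min/1]_j ((\sum_i ispB A r c 0 i j) / c j).
have t0 : 0 < t.
  by apply/bigmin_gtP; split=> // j _; rewrite divr_gt0 ?(scaling_of_col_gt0 h0).
exists t => //; elim=> [j|k IH].
  by rewrite -ler_pdivlMr //; apply: bigmin_le_cond.
have [xy h] := ex_scaling_of_ispB k.
exact: col_ratio_lower_bound h _ t0 (ispB_row k) IH.
Qed.

(** * Limits of the marginals and of the step factors *)

Variable B : 'M[R]_(m, n).
Hypothesis B_lim : ispB A r c @ \oo --> B.

Lemma ispB_cvg i j : (fun k => ispB A r c k i j) @ \oo --> B i j.
Proof. exact: (cvg_comp _ _ B_lim (@coord_continuous _ _ _ i j B)). Qed.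

Lemma sum_cvg (T : finType) (f : nat -> T -> R) (a : T -> R) :
  (forall x, (fun k => f k x) @ \oo --> a x) ->
  (fun k => \sum_x f k x) @ \oo --> \sum_x a x.
Proof.
move=> h; apply: cvg_big => [|x _]; last exact: h.
exact: add_continuous.
Qed.

Let lam j := (\sum_i B i j) / c j.
(** The limit of the i-th row sum of C(k). *)
Let rho i := \sum_j B i j * (c j / \sum_k B k j).
Let mu i := r i / rho i.

Lemma limB_ge0 i j : 0 <= B i j.
Proof.
apply: (cvgr_to_ge (@ispB_cvg i j)); near=> k.
by have [xy h] := ex_scaling_of_ispB k; exact: scaling_of_ge0 h _ _.
Unshelve. all: by end_near. Qed.

Lemma limB_supp i j : B i j != 0 -> A i j != 0.
Proof.
apply: contraNN => /eqP Aij; apply/eqP.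
have E : (fun k => ispB A r c k i j) = fun=> 0.
  apply/funext => k; have [xy [_ _ ->]] := ex_scaling_of_ispB k.
  by rewrite Aij mulr0 mul0r.
have := @ispB_cvg i j; rewrite E => h.
by apply: (cvg_unique _ h (cvg_cst 0)); exact: norm_hausdorff.
Qed.

Lemma limB_row i : \sum_j B i j = r i.
Proof.
have := @sum_cvg _ _ _ (fun j => @ispB_cvg i j).
under eq_fun do rewrite ispB_row; move=> h.
by apply: (cvg_unique _ h (cvg_cst _)); exact: norm_hausdorff.
Qed.

Lemma limB_col_gt0 j : 0 < \sum_i B i j.
Proof.
have [t t0 ht] := ispB_col_lower_bound; apply: (@lt_le_trans _ _ (t * c j)).
  exact: mulr_gt0.
apply: (cvgr_to_ge (@sum_cvg _ _ _ (fun i => @ispB_cvg i j))).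
by near=> k; exact: ht.
Unshelve. all: by end_near. Qed.

Lemma lam_gt0 j : 0 < lam j.
Proof. by rewrite divr_gt0 // limB_col_gt0. Qed.

Lemma rho_gt0 i : 0 < rho i.
Proof.
have w0 j : 0 < c j / \sum_k B k j by rewrite divr_gt0 // limB_col_gt0.
have t0 j : 0 <= B i j * (c j / \sum_k B k j).
  by rewrite mulr_ge0 ?limB_ge0 // ltW.
rewrite lt0r sumr_ge0 // andbT; apply/negP; rewrite psumr_eq0 // => /allP h.
have := r_gt0 i; rewrite -limB_row big1 ?ltxx // => j _.
have := h j; rewrite mem_index_enum => /(_ isT).
by rewrite /= mulf_eq0 (gt_eqF (w0 j)) orbF => /eqP.
Qed.

Let rho_ k i := \sum_j col_scale c (ispB A r c k) i j.

Lemma col_factor_cvg j :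
  (fun k => c j / \sum_i ispB A r c k i j) @ \oo --> (lam j)^-1.
Proof.
rewrite /lam invf_div; apply: cvgM; first exact: cvg_cst.
apply: cvgV; first by rewrite gt_eqF // limB_col_gt0.
exact: (@sum_cvg _ _ _ (fun i => @ispB_cvg i j)).
Qed.

Lemma rho_cvg i : (fun k => rho_ k i) @ \oo --> rho i.
Proof.
apply: sum_cvg => j; under eq_fun do rewrite mxE.
apply: cvgM; first exact: ispB_cvg.
by have := @col_factor_cvg j; rewrite /lam invf_div.
Qed.

Definition step_factor k i j :=
  r i / rho_ k i * (c j / \sum_i' ispB A r c k i' j).

Lemma ispBS k i j : ispB A r c k.+1 i j = step_factor k i j * ispB A r c k i j.
Proof. by rewrite /= mxE [X in _ * X]mxE /step_factor mulrCA mulrC. Qed.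

Lemma step_factor_cvg i j :
  (fun k => step_factor k i j) @ \oo --> mu i / lam j.
Proof.
apply: cvgM; last exact: col_factor_cvg.
apply: cvgM; first exact: cvg_cst.
by apply: cvgV; [rewrite gt_eqF // rho_gt0 | exact: rho_cvg].
Qed.

(** Passing to the limit in [ispBS] shows that [B i j] is fixed by the limit factor [mu i / lam j];
    a nonzero entry can be cancelled. *)
Lemma mu_eq_lam i j : B i j != 0 -> mu i = lam j.
Proof.
move=> Bij; suff E : mu i / lam j * B i j = B i j.
  have : mu i / lam j = 1 by apply: (mulIf Bij); rewrite mul1r.
  by move/divr1_eq.
have h : (fun k => ispB A r c k.+1 i j) @ \oo --> mu i / lam j * B i j.
  under eq_fun do rewrite ispBS.
  by apply: cvgM; [exact: step_factor_cvg | exact: ispB_cvg].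
have h1 : (fun k => ispB A r c k.+1 i j) @ \oo --> B i j.
  by have := @ispB_cvg i j; rewrite -cvg_shiftS.
by apply: (cvg_unique _ h h1); exact: norm_hausdorff.
Qed.

(** Otherwise [B i j] is 0, yet the step factors eventually exceed 1, so the positive entries are
    eventually nondecreasing and cannot tend to 0. *)
Lemma mu_le_lam i j : A i j != 0 -> mu i <= lam j.
Proof.
move=> Aij; rewrite leNgt; apply/negP=> lt.
have B0 : B i j = 0.
  by apply/eqP; apply: contraTT lt => /mu_eq_lam ->; rewrite ltxx.
have b0 k : 0 < ispB A r c k i j.
  by have [xy h] := ex_scaling_of_ispB k; exact: scaling_of_gt0 h _ _ Aij.
have f1 : 1 < mu i / lam j by rewrite ltr_pdivlMr ?mul1r ?lam_gt0.
have [N _ hN] := cvgr_ge _ (@step_factor_cvg i j) _ f1.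
have bN k : ispB A r c N i j <= ispB A r c (k + N) i j.
  elim: k => // k /le_trans; apply; rewrite addSn ispBS ler_peMl ?(ltW (b0 _)) //.
  by apply: hN => /=; rewrite leq_addl.
have := b0 N; rewrite ltNge -B0 => /negP; apply.
apply: (cvgr_to_ge (@ispB_cvg i j)); exists N => // k /= Nk.
by rewrite -(subnK Nk).
Qed.

(** * Growth comparison of accumulated row factors *)

Variable xy : nat -> ('I_m -> R) * ('I_n -> R).
Hypothesis xyP : forall k, scaling_of (ispB A r c k) (xy k).

Let dom i k :=
  exists2 C : R, 0 < C & \forall t \near \oo, (xy t).1 i <= C * (xy t).1 k.

Lemma dom_refl i : dom i i.
Proof. by exists 1 => //; near=> t; rewrite mul1r.
Unshelve. all: by end_near. Qed.

Lemma dom_trans i k l : dom i k -> dom k l -> dom i l.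
Proof.
move=> [C C0 hC] [D D0 hD]; exists (C * D); first exact: mulr_gt0.
near=> t; apply: (@le_trans _ _ (C * (xy t).1 k)); first by near: t.
by rewrite -mulrA ler_pM2l //; near: t.
Unshelve. all: by end_near. Qed.

Lemma limB_lower i j : B i j != 0 -> exists2 d : R, 0 < d &
  \forall t \near \oo, d <= ispB A r c t i j.
Proof.
move=> Bij; have B0 : 0 < B i j by rewrite lt0r limB_ge0 andbT.
exists (B i j / 2); first by rewrite divr_gt0.
by apply: (cvgr_ge _ (@ispB_cvg i j)); rewrite ltr_pdivrMr // mulr_natr mulr2n ltrDl.
Qed.

Lemma limB_upper i j : exists2 M : R, 0 < M &
  \forall t \near \oo, ispB A r c t i j <= M.
Proof.
exists (B i j + 1); first by rewrite ltr_wpDl ?limB_ge0.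
by apply: (cvgr_le _ (@ispB_cvg i j)); rewrite ltrDl.
Qed.

(** In column [j] the entry of row [i] stays bounded and that of row [k] stays away from 0; their
    quotient is free of the column factor. *)
Lemma dom_edge i k j : A i j != 0 -> B k j != 0 -> dom i k.
Proof.
move=> Aij Bkj; have [d d0 hd] := limB_lower Bkj; have [M M0 hM] := limB_upper i j.
have A0 i' : A i' j != 0 -> 0 < A i' j by rewrite lt0r A_ge0 andbT.
have Akj := A0 _ (limB_supp Bkj); have {}Aij := A0 _ Aij.
exists (M / d * (A k j / A i j)); first by rewrite mulr_gt0 ?divr_gt0.
near=> t; have [x0 y0 E] := xyP t.
rewrite -(ler_pM2r Aij) -(ler_pM2r (y0 j)) -E.
apply: (@le_trans _ _ M); first by near: t.
rewrite (_ : _ * (xy t).2 j = M / d * ispB A r c t k j); last first.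
  by rewrite E; field; rewrite !gt_eqF.
rewrite mulrAC ler_pdivlMr // ler_pM2l //; near: t; exact: hd.
Unshelve. all: by end_near. Qed.

(** Since the factor of row [i] is at least that of [k] divided by [C], entry [(i, j)] is at least a
    constant times entry [(k, j)], which stays away from 0. *)
Lemma dom_supp i k j : dom k i -> A i j != 0 -> B k j != 0 -> B i j != 0.
Proof.
move=> [C C0 hC] Aij Bkj; have [d d0 hd] := limB_lower Bkj.
have A0 i' : A i' j != 0 -> 0 < A i' j by rewrite lt0r A_ge0 andbT.
have Akj := A0 _ (limB_supp Bkj); have {}Aij := A0 _ Aij.
suff: A i j / (C * A k j) * d <= B i j.
  by move=> h; rewrite gt_eqF // (lt_le_trans _ h) // mulr_gt0 // divr_gt0 // mulr_gt0.
apply: (cvgr_to_ge (@ispB_cvg i j)); near=> t; have [x0 y0 E] := xyP t.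
apply: (@le_trans _ _ (A i j / (C * A k j) * ispB A r c t k j)).
  by rewrite ler_pM2l ?divr_gt0 ?mulr_gt0 //; near: t.
rewrite !E (_ : _ * _ = (xy t).1 k * (A i j * (xy t).2 j / C)); last first.
  by field; rewrite !gt_eqF.
rewrite (_ : _ * A i j * _ = C * (xy t).1 i * (A i j * (xy t).2 j / C)); last first.
  by field; rewrite gt_eqF.
by rewrite ler_pM2r ?divr_gt0 ?mulr_gt0 //; near: t.
Unshelve. all: by end_near. Qed.

End Iterates.

Theorem mainTheorem1 (R : realType) (m n : nat) (A : 'M[R]_(m, n))
    (r : 'I_m -> R) (c : 'I_n -> R) (B : 'M[R]_(m, n))
    (A_ge0 : forall i j, 0 <= A i j)
    (A_row : forall i, exists j, A i j != 0)
    (A_col : forall j, exists i, A i j != 0)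
    (r_gt0 : forall i, 0 < r i)
    (c_gt0 : forall j, 0 < c j)
    (B_lim : (ispB A r c @ \oo --> B)%classic) :
  (exists S : {set block m n}, algorithm_output A r c S) /\
  (forall S : {set block m n}, algorithm_output A r c S ->
     is_decomposition B S).
Proof.
(* One sequence of accumulated factors is fixed, so that all growth comparisons refer to it. *)
have [xy xyP] := choice (ex_scaling_of_ispB A_ge0 A_row A_col r_gt0 c_gt0).
pose lam j := (\sum_i B i j) / c j.
have B_ge0 := limB_ge0 A_ge0 A_row A_col r_gt0 c_gt0 B_lim.
have B_supp := limB_supp A_ge0 A_row A_col r_gt0 c_gt0 B_lim.
have B_row := limB_row A_ge0 A_row A_col r_gt0 c_gt0 B_lim.
have B_col j : \sum_i B i j = lam j * c j by rewrite divfK // gt_eqF.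
have l_gt0 := lam_gt0 A_ge0 A_row A_col r_gt0 c_gt0 B_lim.
have mu_eq := mu_eq_lam A_ge0 A_row A_col r_gt0 c_gt0 B_lim.
have mu_le := mu_le_lam A_ge0 A_row A_col r_gt0 c_gt0 B_lim.
split.
  exact: (ex_algorithm_output r_gt0 c_gt0 B_ge0 B_supp B_row B_col l_gt0
    mu_eq mu_le).
apply: (algorithm_output_decomposition r_gt0 c_gt0 B_ge0 B_supp B_row B_col
  l_gt0 mu_eq mu_le (dom_refl xy)).
- exact: dom_trans.
- exact: (dom_edge A_ge0 A_row A_col r_gt0 c_gt0 B_lim xyP).
- exact: (dom_supp A_ge0 A_row A_col r_gt0 c_gt0 B_lim xyP).
Qed.
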